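(* Let $G$ be a Dedekind $\sigma$-complete $\ell$-group. Then there exist a set $X$, a $\sigma$-ideal $\mathcal{I}$ of subsets of $X$, and an injective $\sigma$-continuous $\ell$-morphism $\varphi\colon G\to\mathbb{R}^X/\mathcal{I}$.
   Context: A $\sigma$-ideal of subsets of $X$ is a family of subsets of $X$ containing $\emptyset$, closed under subsets and countable unions. $\mathbb{R}^X/\mathcal{I}$ is the quotient $\ell$-group of $\mathbb{R}^X$ (pointwise operations) by the congruence $f\sim g$ iff $\{x: f(x)\ne g(x)\}\in\mathcal{I}$. Dedekind $\sigma$-complete: every countable subset with an upper bound has a supremum; $\sigma$-continuous: preserves existing countable suprema. *)

(* Defs.v *)
From Stdlib Require Import Reals.
Open Scope R_scope.

Record lgroup := LGroup {
  lg_car :> Type;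
  lg_mul : lg_car -> lg_car -> lg_car;
  lg_one : lg_car;
  lg_inv : lg_car -> lg_car;
  lg_le : lg_car -> lg_car -> Prop;
  lg_join : lg_car -> lg_car -> lg_car;
  lg_meet : lg_car -> lg_car -> lg_car;
  lg_mulA : forall a b c, lg_mul a (lg_mul b c) = lg_mul (lg_mul a b) c;
  lg_mul1l : forall a, lg_mul lg_one a = a;
  lg_mulVl : forall a, lg_mul (lg_inv a) a = lg_one;
  lg_le_refl : forall a, lg_le a a;
  lg_le_trans : forall a b c, lg_le a b -> lg_le b c -> lg_le a c;
  lg_le_anti : forall a b, lg_le a b -> lg_le b a -> a = b;
  lg_join_ubl : forall a b, lg_le a (lg_join a b);
  lg_join_ubr : forall a b, lg_le b (lg_join a b);
  lg_join_least : forall a b c, lg_le a c -> lg_le b c -> lg_le (lg_join a b) c;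
  lg_meet_lbl : forall a b, lg_le (lg_meet a b) a;
  lg_meet_lbr : forall a b, lg_le (lg_meet a b) b;
  lg_meet_greatest : forall a b c, lg_le c a -> lg_le c b -> lg_le c (lg_meet a b);
  lg_le_mul : forall a b c d, lg_le a b ->
      lg_le (lg_mul c (lg_mul a d)) (lg_mul c (lg_mul b d))
}.

Arguments lg_le {l} _ _.
Arguments lg_mul {l} _ _.
Arguments lg_join {l} _ _.
Arguments lg_meet {l} _ _.

Definition lg_is_sup (G : lgroup) (a : nat -> G) (s : G) : Prop :=
  (forall n, lg_le (a n) s) /\
  (forall u : G, (forall n, lg_le (a n) u) -> lg_le s u).

(** Dedekind sigma-complete: every (nonempty) countable subset, given as a
    sequence, that is bounded above has a supremum. *)
Definition dedekind_sigma_complete (G : lgroup) : Prop :=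
  forall a : nat -> G, (exists u : G, forall n, lg_le (a n) u) ->
    exists s : G, lg_is_sup G a s.

Definition sigma_ideal (X : Type) (I : (X -> Prop) -> Prop) : Prop :=
  I (fun _ => False) /\
  (forall A B : X -> Prop, (forall x, B x -> A x) -> I A -> I B) /\
  (forall A : nat -> X -> Prop, (forall n, I (A n)) -> I (fun x => exists n, A n x)).

(** The quotient R^X / I, handled through representatives f : X -> R. *)
Definition qeq {X : Type} (I : (X -> Prop) -> Prop) (f g : X -> R) : Prop :=
  I (fun x => f x <> g x).
(* [f] <= [g] in R^X/I (quotient order: [f /\ g] = [f]) *)
Definition qle {X : Type} (I : (X -> Prop) -> Prop) (f g : X -> R) : Prop :=
  I (fun x => g x < f x).
Definition q_is_sup {X : Type} (I : (X -> Prop) -> Prop) (a : nat -> X -> R) (s : X -> R) : Prop :=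
  (forall n, qle I (a n) s) /\
  (forall u : X -> R, (forall n, qle I (a n) u) -> qle I s u).

Definition is_lmorphism (G : lgroup) {X : Type} (I : (X -> Prop) -> Prop) (phi : G -> X -> R) : Prop :=
  (forall a b : G, qeq I (phi (lg_mul a b)) (fun x => phi a x + phi b x)) /\
  (forall a b : G, qeq I (phi (lg_join a b)) (fun x => Rmax (phi a x) (phi b x))) /\
  (forall a b : G, qeq I (phi (lg_meet a b)) (fun x => Rmin (phi a x) (phi b x))).

Definition q_injective (G : lgroup) {X : Type} (I : (X -> Prop) -> Prop) (phi : G -> X -> R) : Prop :=
  forall a b : G, qeq I (phi a) (phi b) -> a = b.

Definition sigma_continuous (G : lgroup) {X : Type} (I : (X -> Prop) -> Prop) (phi : G -> X -> R) : Prop :=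
  forall (a : nat -> G) (s : G), lg_is_sup G a s ->
    q_is_sup I (fun n => phi (a n)) (phi s).

(* Main.v *)
(** Take [X = R^G], [phi a x = x a], and let [I] consist of the sets avoided by all
    points [x] that satisfy suitable countably many relations of the form
    [x (a b) = x a + x b] or [x (sup a_n) = sup x (a_n)].  Everything is then
    immediate except injectivity: given [~ a <= b] and countably many relations
    we need a point satisfying them with [x b < x a].

    The point is built by a Rasiowa-Sikorski argument.  A condition is an element
    [p > 1], and it forces [c <= d] when this holds in [G] modulo the polar of
    [p].  A generic decreasing sequence of conditions below [g = (a b^-1)^+]
    decides all relevant inequalities, keeps every relevant element below a power
    of [g] (the Archimedean property) and forces [s^k <= a_n^k g] for some [n]
    whenever [s = sup a_n].  The resulting total order yields [x] by Dedekind cuts,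
    normalised by [x g = 1].

    Polars are normal and [G] is commutative because sigma-completeness makes [G]
    Archimedean. *)

Require Import Defs.
From Stdlib Require Import Reals Lra Lia Classical IndefiniteDescription.
From Stdlib Require Cantor.
Open Scope R_scope.

Declare Scope lg_scope.
Delimit Scope lg_scope with lg.
Notation "1" := (lg_one _) : lg_scope.
Infix "*" := lg_mul : lg_scope.
Notation "x ^-1" := (lg_inv _ x) (at level 3, left associativity, format "x ^-1") : lg_scope.
Infix "<=" := lg_le : lg_scope.

(** Once [1 / N < y - x], an integer lies strictly between [x N] and [y N]. It is split into a
    difference of naturals because [gpow] takes natural exponents. *)
Lemma rational_between (x y : R) : x < y -> exists N m k : nat,
  (0 < N)%nat /\ x * INR N < INR m - INR k < y * INR N.
Proof.
  intros H. destruct (archimed_cor1 (y - x)) as (N & HN & HN0); [lra|].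
  assert (P : 0 < INR N) by now apply lt_0_INR.
  assert (K : 1 < (y - x) * INR N).
  { apply Rmult_lt_reg_r with (/ INR N); [now apply Rinv_0_lt_compat|].
    rewrite Rmult_assoc, Rinv_r, Rmult_1_r, Rmult_1_l; lra. }
  destruct (archimed (x * INR N)) as [U1 U2]. set (z := up (x * INR N)) in *.
  exists N, (Z.to_nat z), (Z.to_nat (- z)). split; auto.
  replace (INR (Z.to_nat z) - INR (Z.to_nat (- z))) with (IZR z); [split; lra|].
  rewrite !INR_IZR_INZ, <- minus_IZR. f_equal. lia.
Qed.

(** * Lattice-ordered groups *)

Section LGroup.

Variable G : lgroup.
Local Open Scope lg_scope.
Implicit Types a b c d p q r s t v w x y z : G.

Lemma mulKV a b : a^-1 * (a * b) = b.
Proof. now rewrite lg_mulA, lg_mulVl, lg_mul1l. Qed.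

Lemma mul_cancel_l c a b : c * a = c * b -> a = b.
Proof. intros H. now rewrite <- (mulKV c a), H, mulKV. Qed.

Lemma mul1r a : a * 1 = a.
Proof.
  apply (mul_cancel_l a^-1). now rewrite mulKV, lg_mulVl.
Qed.

Lemma mulVr a : a * a^-1 = 1.
Proof. apply (mul_cancel_l a^-1). now rewrite mulKV, mul1r. Qed.

Lemma mulVK a b : a * (a^-1 * b) = b.
Proof. now rewrite lg_mulA, mulVr, lg_mul1l. Qed.

Lemma invK a : a^-1^-1 = a.
Proof. apply (mul_cancel_l a^-1). now rewrite mulVr, lg_mulVl. Qed.

Lemma inv1 : (1 : G)^-1 = 1.
Proof. rewrite <- (lg_mul1l G (1^-1)). apply mulVr. Qed.

Lemma invM a b : (a * b)^-1 = b^-1 * a^-1.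
Proof.
  apply (mul_cancel_l (a * b)).
  now rewrite mulVr, <- lg_mulA, mulVK, mulVr.
Qed.

Ltac gsimpl := repeat first
  [ rewrite <- lg_mulA | rewrite lg_mul1l | rewrite mul1r | rewrite lg_mulVl
  | rewrite mulVr | rewrite mulKV | rewrite mulVK | rewrite invK
  | rewrite inv1 | rewrite invM ].
Ltac gsimpl_in H := repeat first
  [ rewrite <- lg_mulA in H | rewrite lg_mul1l in H | rewrite mul1r in H
  | rewrite lg_mulVl in H | rewrite mulVr in H | rewrite mulKV in H
  | rewrite mulVK in H | rewrite invK in H | rewrite inv1 in H
  | rewrite invM in H ].

Lemma le_mul_l c a b : a <= b -> c * a <= c * b.
Proof. intros H. pose proof (lg_le_mul G a b c 1 H) as K. now gsimpl_in K. Qed.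

Lemma le_mul_r c a b : a <= b -> a * c <= b * c.
Proof. intros H. pose proof (lg_le_mul G a b 1 c H) as K. now gsimpl_in K. Qed.

Lemma le_mul a b c d : a <= b -> c <= d -> a * c <= b * d.
Proof.
  intros H K. apply lg_le_trans with (b * c); auto using le_mul_l, le_mul_r.
Qed.

Lemma le_cancel_l c a b : c * a <= c * b -> a <= b.
Proof. intros H. apply (le_mul_l c^-1) in H. now gsimpl_in H. Qed.

Lemma le_cancel_r c a b : a * c <= b * c -> a <= b.
Proof. intros H. apply (le_mul_r c^-1) in H. now gsimpl_in H. Qed.

Lemma le_inv a b : a <= b -> b^-1 <= a^-1.
Proof.
  intros H. apply (le_cancel_l b), (le_cancel_r a). now gsimpl.
Qed.

Lemma le_mul_ge1_l a b : 1 <= a -> b <= a * b.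
Proof. intros H. apply (le_mul_r b) in H. now gsimpl_in H. Qed.

Lemma le_mul_ge1_r a b : 1 <= a -> b <= b * a.
Proof. intros H. apply (le_mul_l b) in H. now gsimpl_in H. Qed.

Lemma le_mulV_r a b c : a <= b * c -> a * c^-1 <= b.
Proof. intros H. apply (le_cancel_r c). now gsimpl. Qed.

Lemma le_mulV_l a b c : a <= b * c -> b^-1 * a <= c.
Proof. intros H. apply (le_cancel_l b). now gsimpl. Qed.

Fixpoint gpow (x : G) (n : nat) : G :=
  match n with O => 1 | S n => x * gpow x n end.

Local Infix "^" := gpow : lg_scope.

Lemma gpow_add x n m : x ^ (n + m) = x ^ n * x ^ m.
Proof. induction n; simpl; gsimpl; congruence. Qed.

Lemma gpow_mul x n m : x ^ (n * m) = (x ^ m) ^ n.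
Proof. induction n; simpl; auto. now rewrite gpow_add, IHn. Qed.

Lemma gpow_1 n : 1 ^ n = 1.
Proof. induction n; simpl; auto. now rewrite IHn, lg_mul1l. Qed.

Lemma gpow_conj y x n : (y * x * y^-1) ^ n = y * x ^ n * y^-1.
Proof. induction n; simpl; [| rewrite IHn]; now gsimpl. Qed.

Lemma gpow_le x y n : x <= y -> x ^ n <= y ^ n.
Proof. intros H; induction n; simpl; auto using lg_le_refl, le_mul. Qed.

Lemma gpow_ge1 x n : 1 <= x -> 1 <= x ^ n.
Proof. intros H. rewrite <- (gpow_1 n). now apply gpow_le. Qed.

(** With [e] the meet of [x] and [1], the element [x^-1 e] lies below [x] and below [1], hence below
    [e]. *)
Lemma ge1_of_square x : 1 <= x * x -> 1 <= x.
Proof.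
  intros H. set (e := lg_meet x 1).
  pose proof (lg_meet_lbl G x 1) as H1. pose proof (lg_meet_lbr G x 1) as H2.
  fold e in H1, H2.
  apply (le_cancel_r e). rewrite lg_mul1l.
  apply (le_cancel_l x^-1). rewrite mulKV.
  apply lg_meet_greatest; [| now apply le_mulV_l; rewrite mul1r].
  apply le_mulV_l. now apply lg_le_trans with 1.
Qed.

(** * Disjointness and the order modulo a polar *)

(** For [1 <= p] this says that [w] is a positive element of the polar of [p]. *)
Definition orth p w : Prop := 1 <= w /\ forall d, d <= p -> d <= w -> d <= 1.

Lemma orth_one p : orth p 1.
Proof. split; auto using lg_le_refl. Qed.

Lemma orth_sym p w : 1 <= p -> orth p w -> orth w p.
Proof. intros Hp [_ H]. split; auto. Qed.

Lemma orth_mono p p' w : p' <= p -> orth p w -> orth p' w.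
Proof. intros Hp [Hw H]. split; eauto using lg_le_trans. Qed.

Lemma orth_le p v w : 1 <= w -> orth p v -> p <= v * w -> p <= w.
Proof.
  intros Hw [Hv H] Hp.
  apply (le_cancel_r w^-1). rewrite mulVr. apply H.
  - apply le_mulV_r. now apply le_mul_ge1_r.
  - now apply le_mulV_r.
Qed.

Lemma orth_mul p v w : orth p v -> orth p w -> orth p (v * w).
Proof.
  intros Hv [Hw H]. split.
  - apply lg_le_trans with w; auto. apply le_mul_ge1_l, Hv.
  - intros d Hd Hd'. apply H; auto.
    apply orth_le with v; auto. now apply orth_mono with p.
Qed.

Lemma orth_pow p v n : orth p v -> orth p (v ^ n).
Proof. intros H; induction n; simpl; auto using orth_one, orth_mul. Qed.

Lemma orth_pow2 p v n m : 1 <= p -> orth p v -> orth (p ^ n) (v ^ m).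
Proof.
  intros Hp H. pose proof H as [Hv _].
  apply orth_sym, orth_pow, orth_sym, orth_pow; auto.
  now apply gpow_ge1.
Qed.

(** If [d] lies below both parts, then [d v^-1] lies below [x] and [1]. Inverting, [v d^-1]
    dominates [x^-1] and [1], hence [v], and so [d <= 1]. *)
Lemma orth_pos_neg x : orth (lg_join x 1) (lg_join x^-1 1).
Proof.
  split; [apply lg_join_ubr|]. set (v := lg_join x^-1 1). intros d Hu Hd.
  pose proof (lg_join_ubl G x^-1 1) as V1. pose proof (lg_join_ubr G x^-1 1) as V2.
  fold v in V1, V2.
  assert (Hx : d * v^-1 <= x).
  { apply le_mulV_r. apply lg_le_trans with (lg_join x 1); auto.
    apply lg_join_least.
    - now apply le_mul_ge1_r.
    - apply (le_mul_l x) in V1. now rewrite mulVr in V1. }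
  assert (H1 : d * v^-1 <= 1) by (apply le_mulV_r; now rewrite lg_mul1l).
  apply le_inv in Hx, H1. gsimpl_in Hx. gsimpl_in H1.
  assert (K : v <= v * d^-1) by now apply lg_join_least.
  apply (le_cancel_r d^-1), (le_cancel_l v). now gsimpl.
Qed.

(** * The Archimedean property and normality of polars *)

Definition archimedean : Prop :=
  forall p a, (forall n, p ^ n <= a) -> p <= 1.

(** If [s] is the supremum of the powers of [p], then [p^-1 s] is again an upper bound, so
    [s <= p^-1 s]. *)
Lemma sigma_complete_archimedean : dedekind_sigma_complete G -> archimedean.
Proof.
  intros HG p a H. destruct (HG (fun n => p ^ n)) as [s [Hs1 Hs2]]; [now exists a|].
  apply (le_cancel_r s). rewrite lg_mul1l.
  rewrite <- (mulVK p s) at 2. apply le_mul_l. apply Hs2. intros n.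
  apply (le_cancel_l p). rewrite mulVK. apply (Hs1 (S n)).
Qed.

Hypothesis arch : archimedean.

(* If [y >= 1] moves [q] off itself then [q^n <= y] for all [n]. *)
Lemma orth_own_conj q y : 1 <= q -> 1 <= y -> orth q (y * q * y^-1) -> q <= 1.
Proof.
  intros Hq Hy H. apply arch with y. intros n.
  pose proof (orth_pow2 _ _ n n Hq H) as [_ K]. rewrite gpow_conj in K.
  apply (le_cancel_r y^-1). rewrite mulVr. apply K.
  - apply le_mulV_r. now apply le_mul_ge1_r, Hy.
  - apply le_mul_r. now apply le_mul_ge1_l.
Qed.

(** For [x] comparable with [1], let [q] be the positive part of an element below [p] and
    [x w x^-1]: it is disjoint from [x^-1 q x], so [q <= 1] by [orth_own_conj]. A general [x] is a
    product of a factor above [1] and one below. *)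
Lemma orth_conj p w x : 1 <= p -> orth p w -> orth p (x * w * x^-1).
Proof.
  intros Hp.
  assert (Hone : forall x w, 1 <= w -> 1 <= x * w * x^-1).
  { intros x0 w0 Hw0. apply (le_mul_l x0), (le_mul_r x0^-1) in Hw0.
    gsimpl_in Hw0. now gsimpl. }
  assert (Hmain : forall x w, (1 <= x \/ x <= 1) -> orth p w -> orth p (x * w * x^-1)).
  { clear x w. intros x w Hx [Hw H]. split; auto.
    intros d Hd Hd'. set (q := lg_join d 1).
    assert (Hq1 : 1 <= q) by apply lg_join_ubr.
    assert (Hqp : q <= p) by (apply lg_join_least; auto).
    assert (Hqw : x^-1 * q * x <= w).
    { apply (le_cancel_l x), (le_cancel_r x^-1). gsimpl.
      rewrite lg_mulA. now apply lg_join_least; auto. }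
    assert (Hdis : forall e, e <= q -> e <= x^-1 * q * x -> e <= 1)
      by eauto using lg_le_trans.
    apply lg_le_trans with q; [apply lg_join_ubl|].
    destruct Hx as [Hx | Hx].
    - apply orth_own_conj with x; auto. split; auto.
      intros e He He'.
      assert (K : x^-1 * e * x <= 1).
      { apply Hdis.
        - apply (le_cancel_l x), (le_cancel_r x^-1). gsimpl. now gsimpl_in He'.
        - apply le_mul_r, le_mul_l, He. }
      apply (le_mul_l x), (le_mul_r x^-1) in K. now gsimpl_in K.
    - apply orth_own_conj with x^-1; auto.
      + apply le_inv in Hx. now gsimpl_in Hx.
      + rewrite invK. split; auto.
        specialize (Hone x^-1 q Hq1). now rewrite invK in Hone. }
  intros H. set (y := lg_join x 1).
  assert (K : orth p (y * ((y^-1 * x) * w * (y^-1 * x)^-1) * y^-1)).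
  { apply Hmain; [left; apply lg_join_ubr|]. apply Hmain; auto. right.
    apply le_mulV_l. rewrite mul1r. apply lg_join_ubl. }
  gsimpl_in K. now gsimpl.
Qed.

(** * Conditions and the inequalities they force *)

Definition cond p : Prop := 1 <= p /\ ~ p <= 1.

(** The order modulo the polar of [p]. Smaller conditions have larger polars and so force more. *)
Definition ple p a b : Prop := exists w, orth p w /\ a <= w * b.

Lemma ple_of_le p a b : a <= b -> ple p a b.
Proof. intros H. exists 1. split; [apply orth_one | now rewrite lg_mul1l]. Qed.

Lemma ple_refl p a : ple p a a.
Proof. apply ple_of_le, lg_le_refl. Qed.

Lemma ple_trans p a b c : ple p a b -> ple p b c -> ple p a c.
Proof.
  intros (v & Hv & H) (w & Hw & K). exists (v * w).
  split; [now apply orth_mul|]. apply lg_le_trans with (v * b); auto.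
  rewrite <- lg_mulA. now apply le_mul_l.
Qed.

Lemma ple_mono p p' a b : p' <= p -> ple p a b -> ple p' a b.
Proof. intros Hp (w & Hw & H). exists w. eauto using orth_mono. Qed.

(** Normality of the polar enters here: [w] is moved past [b] as [b w b^-1]. *)
Lemma ple_mul p a b c d : 1 <= p -> ple p a b -> ple p c d -> ple p (a * c) (b * d).
Proof.
  intros Hp (v & Hv & H) (w & Hw & K). exists (v * (b * w * b^-1)). split.
  - now apply orth_mul, orth_conj.
  - gsimpl. rewrite (lg_mulA _ v). now apply le_mul.
Qed.

Lemma ple_cancel_l p c a b : 1 <= p -> ple p (c * a) (c * b) -> ple p a b.
Proof.
  intros Hp H. rewrite <- (mulKV c a), <- (mulKV c b).
  apply ple_mul; auto using ple_refl.
Qed.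

Lemma ple_cancel_r p c a b : 1 <= p -> ple p (a * c) (b * c) -> ple p a b.
Proof.
  intros Hp H. pose proof (ple_mul _ _ _ _ _ Hp H (ple_refl p c^-1)) as K.
  now gsimpl_in K.
Qed.

Lemma not_ple_one p : cond p -> ~ ple p p 1.
Proof.
  intros [Hp Hn] (w & [Hw H] & K). rewrite mul1r in K. auto using lg_le_refl.
Qed.

(** With [u] and [v] the positive and negative parts of [z], [u <= v z] and [v] is disjoint from
    [u]. *)
Lemma ple_pos_part z : ple (lg_join z 1) (lg_join z 1) z.
Proof.
  exists (lg_join z^-1 1). split; [apply orth_pos_neg|]. apply lg_join_least.
  - apply le_mul_ge1_l, lg_join_ubr.
  - pose proof (le_mul_r z _ _ (lg_join_ubl G z^-1 1)) as K. now gsimpl_in K.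
Qed.

Lemma cond_pos_part z : ~ z <= 1 -> cond (lg_join z 1).
Proof.
  intros H. split; [apply lg_join_ubr|]. contradict H.
  eapply lg_le_trans; [apply lg_join_ubl | apply H].
Qed.

(** Consider the meet of [p] with the positive part of [z]. If it is trivial, that part lies in the
    polar of [p]; otherwise the meet is the new condition. *)
Lemma ple_le_one_or p z : cond p ->
  ple p z 1 \/ exists p', cond p' /\ p' <= p /\ ple p' p' z.
Proof.
  intros [Hp Hn]. set (p' := lg_meet p (lg_join z 1)).
  assert (Hp' : 1 <= p') by (apply lg_meet_greatest; auto; apply lg_join_ubr).
  destruct (classic (p' <= 1)) as [H | H].
  - left. exists (lg_join z 1). split; [split; [apply lg_join_ubr|]|].
    + intros d Hd Hd'. apply lg_le_trans with p'; auto. now apply lg_meet_greatest.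
    + rewrite mul1r. apply lg_join_ubl.
  - right. exists p'. split; [now split|]. split; [apply lg_meet_lbl|].
    apply ple_trans with (lg_join z 1); [apply ple_of_le, lg_meet_lbr|].
    apply ple_mono with (lg_join z 1); [apply lg_meet_lbr | apply ple_pos_part].
Qed.

Lemma ple_total p a b : cond p ->
  ple p a b \/ exists p', cond p' /\ p' <= p /\ ple p' b a.
Proof.
  intros Hp. destruct (ple_le_one_or p (a * b^-1) Hp) as [H | (p' & Hp' & Hle & H)].
  - left. apply (ple_cancel_r p b^-1); [apply Hp | now rewrite mulVr].
  - right. exists p'. repeat split; try apply Hp'; auto.
    apply (ple_cancel_r p' b^-1); [apply Hp'|]. rewrite mulVr.
    apply ple_trans with p'; auto. apply ple_of_le, Hp'.
Qed.

(** If this fails, [ple_total] makes [p] force [g^n <= a] for every [n]. Since [p^n <= g^n] and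
    [p^n] is disjoint from the polar factor, the join of [a] and [1] bounds all [p^n], against the
    Archimedean property. *)
Lemma ple_pow_bound p g a : cond p -> p <= g ->
  exists p' n, cond p' /\ p' <= p /\ ple p' a (g ^ n).
Proof.
  intros Hp Hg. apply NNPP. intros Hno. apply (proj2 Hp).
  apply arch with (lg_join a 1). intros n.
  destruct (ple_total p (g ^ n) a Hp) as [(w & Hw & H) | (p' & H)].
  - apply orth_le with w; [apply lg_join_ubr | |].
    + apply orth_sym; [apply Hw|]. apply orth_pow, orth_sym; [apply Hp | auto].
    + apply lg_le_trans with (g ^ n); [now apply gpow_le|].
      apply lg_le_trans with (w * a); auto. apply le_mul_l, lg_join_ubl.
  - contradict Hno. exists p', n. tauto.
Qed.

(** Descend from the exponent given by [ple_pow_bound]: either the condition forces [a <= t^n] and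
    the search goes on, or an extension forces [t^n <= a] and it stops. *)
Lemma ple_sandwich p t a : 1 <= a -> cond p -> p <= t ->
  exists p' k, cond p' /\ p' <= p /\ ple p' (t ^ k) a /\ ple p' a (t ^ S k).
Proof.
  intros Ha Hp Ht. destruct (ple_pow_bound p t a Hp Ht) as (p1 & n & Hp1 & Hle & H).
  enough (exists p' k, cond p' /\ p' <= p1 /\ ple p' (t ^ k) a /\ ple p' a (t ^ S k))
    as (p' & k & K1 & K2 & K3) by (exists p', k; eauto using lg_le_trans).
  assert (Ht1 : p1 <= t) by eauto using lg_le_trans.
  clear p Hp Ht Hle. revert p1 Hp1 Ht1 H.
  induction n as [|n IH]; intros p Hp Ht H.
  - exists p, O. repeat split; try apply Hp; auto using lg_le_refl, ple_of_le.
    apply ple_trans with (t ^ 0); auto. apply ple_of_le. simpl.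
    rewrite mul1r. apply lg_le_trans with p; [apply Hp | auto].
  - destruct (ple_total p a (t ^ n) Hp) as [K | (p1 & Hp1 & Hle & K)].
    + now apply IH.
    + exists p1, n. repeat split; try apply Hp1; auto. eapply ple_mono; eauto.
Qed.

(** * Commutativity *)

(* Hoelder's argument, carried out below a condition [p] on which
   [c := (a b) (b a)^-1] is positive.  Either some [t] satisfies [t^3 <= c], and
   sandwiching [a], [b] between consecutive powers of [t] gives [c <= t^2], or
   there is a locally minimal [t], and [a], [b] are locally powers of [t]. *)
Lemma le_mul_comm a b : 1 <= a -> 1 <= b -> a * b <= b * a.
Proof.
  intros Ha Hb. set (c := a * b * (b * a)^-1).
  assert (Hc : c * (b * a) = a * b) by (unfold c; now gsimpl).
  enough (c <= 1) as K by (apply (le_mul_r (b * a)) in K; now rewrite Hc, lg_mul1l in K).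
  apply NNPP. intros Hn.
  set (p0 := lg_join c 1). assert (Hp0 : cond p0) by now apply cond_pos_part.
  assert (Hp0c : ple p0 p0 c) by apply ple_pos_part.
  (* Since [c t^(l+k) <= c b a = a b <= t^(k+l+2)], the condition forces [c <= t^2], and [t^3 <= c]
     would give [t <= 1]. *)
  assert (Hcube : forall t, cond t -> ~ ple t (t * (t * t)) c).
  { intros t Ht K.
    destruct (ple_sandwich t t a Ha Ht (lg_le_refl _ _)) as (p1 & k & Hp1 & L1 & A1 & A2).
    destruct (ple_sandwich p1 t b Hb Hp1 L1) as (p2 & l & Hp2 & L2 & B1 & B2).
    pose proof (proj1 Hp2) as P.
    apply (ple_mono _ p2) in A1, A2; auto.
    apply (ple_mono _ p2) in K; [| eauto using lg_le_trans].
    apply (not_ple_one p2); auto.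
    apply ple_trans with t; [apply ple_of_le; eauto using lg_le_trans|].
    apply (ple_cancel_l p2 (t * t)); auto. rewrite mul1r.
    apply (ple_cancel_r p2 (t ^ (l + k))); auto.
    apply ple_trans with (a * b).
    - rewrite <- Hc. apply ple_mul; auto; [now rewrite <- lg_mulA|].
      rewrite gpow_add. now apply ple_mul.
    - replace (t * t * t ^ (l + k)) with (t ^ S k * t ^ S l); [now apply ple_mul|].
      rewrite <- gpow_add. replace (S k + S l)%nat with (S (S (l + k))) by lia.
      simpl. now gsimpl. }
  assert (Hmin : exists t, cond t /\ t <= p0 /\
    forall s, cond s -> s <= t -> ~ ple s (s * s) t).
  { apply NNPP. intros Hno.
    assert (Hstep : forall t, cond t -> t <= p0 ->
      exists s, cond s /\ s <= t /\ ple s (s * s) t).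
    { intros t Ht Hle. apply NNPP. intros K. apply Hno. exists t. repeat split; try apply Ht; auto.
      intros s H1 H2 H3. apply K. now exists s. }
    (* Two refinements suffice: [r^2 <= s] and [r <= s] give [r^3 <= s^2 <= p0 <= c]. *)
    destruct (Hstep p0 Hp0 (lg_le_refl _ _)) as (s & Hs & Ls & Ks).
    destruct (Hstep s Hs Ls) as (r & Hr & Lr & Kr).
    apply (Hcube r Hr). pose proof (proj1 Hr) as R1.
    assert (L : ple r (r * (r * r)) (s * s)).
    { rewrite lg_mulA. apply ple_mul; auto. now apply ple_of_le. }
    apply ple_trans with (s * s); auto.
    apply ple_trans with p0; [apply ple_mono with s | apply ple_mono with p0];
      eauto using lg_le_trans. }
  destruct Hmin as (t & Ht & Lt & Hmin).
  (* Locally nothing lies strictly between [1] and [t]: if [r] and [t r^-1] both dominated a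
     condition [p2], then [p2^2 <= t], against minimality. *)
  assert (Hatom : forall p r, cond p -> p <= t ->
    exists p', cond p' /\ p' <= p /\ (ple p' r 1 \/ ple p' t r)).
  { intros p r Hp Lp.
    destruct (ple_le_one_or p r Hp) as [H | (p1 & Hp1 & L1 & H)].
    - exists p. auto using lg_le_refl.
    - destruct (ple_total p1 t r Hp1) as [K | _].
      + exists p1. auto.
      + destruct (ple_le_one_or p1 (t * r^-1) Hp1) as [K | (p2 & Hp2 & L2 & K)].
        * exists p1. repeat split; try apply Hp1; auto. right.
          apply (ple_cancel_r p1 r^-1); [apply Hp1 | now rewrite mulVr].
        * exfalso. apply (Hmin p2); eauto using lg_le_trans.
          replace t with (t * r^-1 * r) by now gsimpl.
          apply ple_mul; [apply Hp2 | auto |].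
          apply ple_trans with p1; [now apply ple_of_le | now apply ple_mono with p1]. }
  assert (Hpow : forall p x, 1 <= x -> cond p -> p <= t ->
    exists p' k, cond p' /\ p' <= p /\ ple p' (t ^ k) x /\ ple p' x (t ^ k)).
  { intros p x Hx Hp Lp.
    destruct (ple_sandwich p t x Hx Hp Lp) as (p1 & k & Hp1 & L1 & A1 & A2).
    (* The element [x t^(-k)] is forced between [1] and [t], so [x] is locally [t^k] or
       [t^(k+1)]. *)
    destruct (Hatom p1 (x * (t ^ k)^-1) Hp1) as (p2 & Hp2 & L2 & K);
      [eauto using lg_le_trans|].
    apply (ple_mono _ p2) in A1, A2; auto. pose proof (proj1 Hp2) as P.
    destruct K as [K | K].
    - exists p2, k. split; [auto|]. split; [eauto using lg_le_trans|]. split; auto.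
      apply (ple_cancel_r p2 (t ^ k)^-1); auto. now rewrite mulVr.
    - exists p2, (S k). split; [auto|]. split; [eauto using lg_le_trans|]. split; auto.
      apply (ple_cancel_r p2 (t ^ k)^-1); auto. simpl. now gsimpl. }
  destruct (Hpow t a Ha Ht (lg_le_refl _ _)) as (p1 & k & Hp1 & L1 & A1 & A2).
  destruct (Hpow p1 b Hb Hp1 L1) as (p2 & l & Hp2 & L2 & B1 & B2).
  apply (ple_mono _ p2) in A1, A2; auto. pose proof (proj1 Hp2) as P.
  apply (not_ple_one p2); auto.
  assert (L0 : p2 <= p0) by eauto using lg_le_trans.
  apply ple_trans with c.
  - apply ple_trans with p0; [now apply ple_of_le | now apply ple_mono with p0].
  - apply (ple_cancel_r p2 (b * a)); auto. rewrite Hc, lg_mul1l.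
    apply ple_trans with (t ^ k * t ^ l); [now apply ple_mul|].
    rewrite <- gpow_add, Nat.add_comm, gpow_add. now apply ple_mul.
Qed.

(** Every element is [v^-1 u] with [u] and [v] positive, and positive elements commute by
    [le_mul_comm]. *)
Lemma lg_mulC a b : a * b = b * a.
Proof.
  assert (Hpos : forall a b, 1 <= a -> 1 <= b -> a * b = b * a)
    by (intros; apply lg_le_anti; auto using le_mul_comm).
  assert (Hinv : forall a b, a * b = b * a -> a^-1 * b = b * a^-1).
  { intros x y E. apply (mul_cancel_l x). rewrite mulVK, lg_mulA, E. now gsimpl. }
  assert (Hmul : forall a b c, a * c = c * a -> b * c = c * b -> (a * b) * c = c * (a * b)).
  { intros x y z E F. now rewrite <- lg_mulA, F, lg_mulA, E, <- lg_mulA. }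
  assert (Hdec : forall a, exists u v, 1 <= u /\ 1 <= v /\ a = v^-1 * u).
  { intros x. exists (lg_join x 1), (lg_join x 1 * x^-1).
    split; [apply lg_join_ubr | split].
    - apply (le_cancel_r x). gsimpl. apply lg_join_ubl.
    - now gsimpl. }
  destruct (Hdec a) as (u & v & Hu & Hv & ->), (Hdec b) as (u' & v' & Hu' & Hv' & ->).
  apply Hmul; [apply Hinv|]; symmetry; apply Hmul; try apply Hinv; auto.
Qed.

(** * Powers, meets and suprema in the commutative group *)

Lemma mulACA a b c d : (a * b) * (c * d) = (a * c) * (b * d).
Proof. gsimpl. f_equal. now rewrite !lg_mulA, (lg_mulC b). Qed.

Lemma gpow_mulM x y n : (x * y) ^ n = x ^ n * y ^ n.
Proof. induction n; simpl; [now gsimpl | rewrite IHn; apply mulACA]. Qed.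

(** Through this identity, preservation of meets will follow from that of products and joins. *)
Lemma meet_mul_join a b : lg_meet a b * lg_join a b = a * b.
Proof.
  set (e := lg_meet a b). set (j := lg_join a b). apply lg_le_anti.
  - apply (le_cancel_l e^-1). rewrite mulKV. apply lg_join_least.
    + apply (le_cancel_l e). rewrite mulVK, lg_mulC. apply le_mul_l, lg_meet_lbr.
    + apply (le_cancel_l e). rewrite mulVK. apply le_mul_r, lg_meet_lbl.
  - apply (le_cancel_r j^-1). gsimpl. apply lg_meet_greatest.
    + apply (le_cancel_r j). gsimpl. apply le_mul_l, lg_join_ubr.
    + apply (le_cancel_r j). gsimpl. rewrite lg_mulC. apply le_mul_l, lg_join_ubl.
Qed.

Lemma le_of_square x y : x * x <= y * y -> x <= y.
Proof.
  intros H. apply (le_cancel_r x^-1). rewrite mulVr. apply ge1_of_square.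
  rewrite mulACA. apply (le_mul_r (x^-1 * x^-1)) in H. now gsimpl_in H; gsimpl.
Qed.

(* To double the exponent, the hypotheses for [n] and [m] are multiplied and the
   square root taken: [p a_n^k a_m^k <= s^(2k)]. *)
Lemma sup_pow (a : nat -> G) s : lg_is_sup G a s -> forall j p,
  (forall n, p * a n ^ Nat.pow 2 j <= s ^ Nat.pow 2 j) -> p <= 1.
Proof.
  intros [Hs1 Hs2]. induction j as [|j IH]; intros p H.
  - apply (le_cancel_r s). rewrite lg_mul1l.
    rewrite <- (mulVK p s) at 2. apply le_mul_l. apply Hs2. intros n.
    specialize (H n). simpl in H. rewrite !mul1r in H.
    apply (le_cancel_l p). now rewrite mulVK.
  - replace (Nat.pow 2 (S j)) with (Nat.pow 2 j + Nat.pow 2 j)%nat in H by (simpl; lia).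
    (* The induction hypothesis is used twice: for [p], then for [p a_m^k s^(-k)] with a second
       index [n]. *)
    set (k := Nat.pow 2 j) in *. apply IH. intros m.
    enough (K : p * a m ^ k * (s ^ k)^-1 <= 1).
    { apply (le_mul_r (s ^ k)) in K. now gsimpl_in K. }
    apply IH. intros n.
    assert (K : p * (a m ^ k * a n ^ k) <= s ^ k * s ^ k).
    { apply le_of_square. rewrite mulACA, (mulACA (a m ^ k)), <- mulACA.
      pose proof (H m) as Hm. pose proof (H n) as Hn. rewrite !gpow_add in Hm, Hn.
      now apply le_mul. }
    apply (le_cancel_r (s ^ k)). rewrite <- !lg_mulA, (lg_mulC (s ^ k)^-1).
    now gsimpl.
Qed.

(** Otherwise [p] forces [a_n^K g <= s^K] for every [n], where [K = 2^j]. As [p <= g] and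
    [s^K a_n^(-K) >= 1], the polar factor drops out, leaving [p a_n^K <= s^K], and [sup_pow] yields
    [p <= 1]. *)
Lemma ple_sup (a : nat -> G) s j p g : lg_is_sup G a s -> cond p -> p <= g ->
  exists p' n, cond p' /\ p' <= p /\
    ple p' (s ^ Nat.pow 2 j) (a n ^ Nat.pow 2 j * g).
Proof.
  intros Hs Hp Hg. apply NNPP. intros Hno. apply (proj2 Hp).
  apply (sup_pow a s Hs j). intros n.
  destruct (ple_total p (a n ^ Nat.pow 2 j * g) (s ^ Nat.pow 2 j) Hp)
    as [(w & Hw & H) | (p' & H)].
  - set (k := Nat.pow 2 j) in *.
    apply (le_cancel_r (a n ^ k)^-1). rewrite <- lg_mulA, mulVr, mul1r.
    apply orth_le with w; auto.
    + apply (le_cancel_r (a n ^ k)). gsimpl. apply gpow_le, Hs.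
    + rewrite lg_mulA. apply (le_cancel_r (a n ^ k)). rewrite <- !lg_mulA, lg_mulVl, mul1r.
      eapply lg_le_trans; [|apply H]. rewrite lg_mulC. now apply le_mul_l.
  - contradict Hno. exists p', n. tauto.
Qed.

(** The Rasiowa-Sikorski construction by choice: requirement [n] is met at stage [n + 1]. *)
Lemma generic_sequence g (D : nat -> G -> Prop) : cond g ->
  (forall n p, cond p -> p <= g -> exists p', cond p' /\ p' <= p /\ D n p') ->
  exists P : nat -> G, P O = g /\ (forall n, cond (P n)) /\
    (forall n, P (S n) <= P n) /\ (forall n, D n (P (S n))).
Proof.
  intros Hg HD.
  destruct (functional_choice (fun (np : nat * G) p' =>
    cond (snd np) -> snd np <= g -> cond p' /\ p' <= snd np /\ D (fst np) p')) as [f Hf].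
  { intros [n p]. simpl.
    destruct (classic (cond p /\ p <= g)) as [[H1 H2] | H].
    - destruct (HD n p H1 H2) as [p' H]. now exists p'.
    (* A dummy value where the premises fail. *)
    - exists g. tauto. }
  set (P := fix P n := match n with O => g | S n => f (n, P n) end).
  assert (HP : forall n, cond (P n) /\ P n <= g).
  { induction n as [|n [H1 H2]]; simpl; [auto using lg_le_refl|].
    destruct (Hf (n, P n) H1 H2) as (K1 & K2 & _). eauto using lg_le_trans. }
  exists P. split; [reflexivity|]. repeat split; try apply HP;
    intros n; destruct (HP n) as [H1 H2]; apply (Hf (n, P n) H1 H2).
Qed.

(** * The real valuation of a total order *)

Section Valuation.

Variables (g : G) (Q : G -> G -> Prop).
Hypothesis g_ge1 : 1 <= g.
Hypothesis Q_le : forall a b, a <= b -> Q a b.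
Hypothesis Q_trans : forall a b c, Q a b -> Q b c -> Q a c.
Hypothesis Q_mul : forall a b c d, Q a b -> Q c d -> Q (a * c) (b * d).
Hypothesis Q_nontrivial : ~ Q g 1.

(** Additively, the rational [r = (m - k) / N] satisfies [r g <= a] for [Q]. Two natural exponents
    replace a possibly negative one. *)
Definition lower a (r : R) : Prop := exists N m k : nat,
  (0 < N)%nat /\ (r * INR N = INR m - INR k)%R /\ Q (g ^ m) (a ^ N * g ^ k).

Definition upper a (r : R) : Prop := exists N m k : nat,
  (0 < N)%nat /\ (r * INR N = INR m - INR k)%R /\ Q (a ^ N * g ^ k) (g ^ m).

Definition decided a : Prop := forall N m k : nat,
  Q (g ^ m) (a ^ N * g ^ k) \/ Q (a ^ N * g ^ k) (g ^ m).

Definition bounded a : Prop := exists n, Q a (g ^ n) /\ Q 1 (a * g ^ n).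

(** The number [r] fills the Dedekind cut of [a]. It is unique when [a] is decided, as every
    rational is then on one side. *)
Definition value a (r : R) : Prop :=
  (forall l, lower a l -> (l <= r)%R) /\ (forall u, upper a u -> (r <= u)%R).

Lemma Q_refl a : Q a a.
Proof. apply Q_le, lg_le_refl. Qed.

Lemma Q_pow a b n : Q a b -> Q (a ^ n) (b ^ n).
Proof. intros H; induction n; simpl; auto using Q_refl. Qed.

Lemma Q_gpow m k : Q (g ^ m) (g ^ k) -> (m <= k)%nat.
Proof.
  intros H. destruct (Nat.le_gt_cases m k) as [|L]; auto. exfalso. apply Q_nontrivial.
  replace m with (k + S (m - k - 1))%nat in H by lia. rewrite gpow_add in H.
  apply (Q_mul _ _ _ _ (Q_refl (g ^ k)^-1)) in H. gsimpl_in H.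
  apply Q_trans with (g ^ S (m - k - 1)); auto. apply Q_le. simpl.
  now apply le_mul_ge1_r, gpow_ge1.
Qed.

Lemma scale_eq M N k a : (a ^ N * g ^ k) ^ M = a ^ (M * N) * g ^ (M * k).
Proof. now rewrite gpow_mulM, <- !gpow_mul. Qed.

Lemma lower_scale M N m k a : Q (g ^ m) (a ^ N * g ^ k) ->
  Q (g ^ (M * m)) (a ^ (M * N) * g ^ (M * k)).
Proof. intros H. apply (Q_pow _ _ M) in H. now rewrite scale_eq, <- gpow_mul in H. Qed.

Lemma upper_scale M N m k a : Q (a ^ N * g ^ k) (g ^ m) ->
  Q (a ^ (M * N) * g ^ (M * k)) (g ^ (M * m)).
Proof. intros H. apply (Q_pow _ _ M) in H. now rewrite scale_eq, <- gpow_mul in H. Qed.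

(** Over the common denominator [N M], transitivity eliminates the power of [a] and leaves two
    powers of [g]. *)
Lemma lower_le_upper a l u : lower a l -> upper a u -> (l <= u)%R.
Proof.
  intros (N & m & k & HN & El & H) (M & i & j & HM & Eu & K).
  apply (lower_scale M) in H. apply (upper_scale N) in K.
  assert (L : Q (g ^ (M * m + N * j)) (g ^ (N * i + M * k))).
  { rewrite !gpow_add.
    apply Q_trans with (a ^ (M * N) * g ^ (M * k) * g ^ (N * j)); auto using Q_refl.
    rewrite <- lg_mulA, (lg_mulC (g ^ (M * k))), lg_mulA, (Nat.mul_comm M N).
    auto using Q_refl. }
  apply Q_gpow, le_INR in L. rewrite !plus_INR, !mult_INR in L.
  apply lt_0_INR in HN, HM.
  apply Rmult_le_reg_r with (INR N * INR M)%R; [now apply Rmult_lt_0_compat|].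
  replace (l * (INR N * INR M))%R with (INR M * (l * INR N))%R by ring.
  replace (u * (INR N * INR M))%R with (INR N * (u * INR M))%R by ring.
  rewrite El, Eu. lra.
Qed.

Lemma value_exists a : bounded a -> exists r : R, value a r.
Proof.
  intros (n & H1 & H2).
  destruct (completeness (lower a)) as (r & U & L).
  - exists (INR n). intros l Hl. apply lower_le_upper with a; auto.
    exists 1%nat, n, 0%nat. repeat split; [lia | simpl; lra |].
    simpl. now rewrite !mul1r.
  - exists (- INR n)%R. exists 1%nat, 0%nat, n. repeat split; [lia | simpl; lra |].
    simpl. now rewrite !mul1r.
  - exists r. split; auto. intros u Hu. apply L. intros l Hl.
    now apply lower_le_upper with a.
Qed.

(** A rational strictly between [q] and [r] is lower or upper, and upper rationals are at least
    [r]. *)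
Lemma lower_below a (r q : R) : decided a -> value a r -> (q < r)%R ->
  exists l, lower a l /\ (q < l)%R.
Proof.
  intros Ha [_ Hr] H. destruct (rational_between _ _ H) as (N & m & k & HN & K1 & K2).
  assert (P : (0 < INR N)%R) by now apply lt_0_INR.
  set (d := ((INR m - INR k) / INR N)%R).
  assert (Ed : (d * INR N = INR m - INR k)%R) by (unfold d; field; lra).
  assert (D : (q < d < r)%R) by (split; apply Rmult_lt_reg_r with (INR N); lra).
  exists d. split; [|tauto].
  destruct (Ha N m k) as [A | A]; [now exists N, m, k|].
  assert (U : upper a d) by now exists N, m, k.
  specialize (Hr _ U). lra.
Qed.

Lemma upper_above a (r q : R) : decided a -> value a r -> (r < q)%R ->
  exists u, upper a u /\ (u < q)%R.
Proof.
  intros Ha [Hr _] H. destruct (rational_between _ _ H) as (N & m & k & HN & K1 & K2).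
  assert (P : (0 < INR N)%R) by now apply lt_0_INR.
  set (d := ((INR m - INR k) / INR N)%R).
  assert (Ed : (d * INR N = INR m - INR k)%R) by (unfold d; field; lra).
  assert (D : (r < d < q)%R) by (split; apply Rmult_lt_reg_r with (INR N); lra).
  exists d. split; [|tauto].
  destruct (Ha N m k) as [A | A]; [|now exists N, m, k].
  assert (U : lower a d) by now exists N, m, k.
  specialize (Hr _ U). lra.
Qed.

Lemma lower_mul a b l l' : lower a l -> lower b l' -> lower (a * b) (l + l').
Proof.
  intros (N & m & k & HN & E & H) (M & i & j & HM & F & K).
  exists (M * N)%nat, (M * m + N * i)%nat, (M * k + N * j)%nat.
  split; [now apply Nat.mul_pos_pos | split].
  - rewrite !plus_INR, !mult_INR.
    replace ((l + l') * (INR M * INR N))%R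
      with (INR M * (l * INR N) + INR N * (l' * INR M))%R by ring.
    rewrite E, F. ring.
  - apply (lower_scale M) in H. apply (lower_scale N) in K.
    rewrite !gpow_add, gpow_mulM, mulACA, (Nat.mul_comm M N) in *. auto.
Qed.

Lemma upper_mul a b u u' : upper a u -> upper b u' -> upper (a * b) (u + u').
Proof.
  intros (N & m & k & HN & E & H) (M & i & j & HM & F & K).
  exists (M * N)%nat, (M * m + N * i)%nat, (M * k + N * j)%nat.
  split; [now apply Nat.mul_pos_pos | split].
  - rewrite !plus_INR, !mult_INR.
    replace ((u + u') * (INR M * INR N))%R
      with (INR M * (u * INR N) + INR N * (u' * INR M))%R by ring.
    rewrite E, F. ring.
  - apply (upper_scale M) in H. apply (upper_scale N) in K.
    rewrite !gpow_add, gpow_mulM, mulACA, (Nat.mul_comm M N) in *. auto.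
Qed.

(** If [t] exceeded [r + s], upper rationals within half the excess of [r] and [s] would add up to
    one of [a b] below [t]; dually for lower ones. *)
Lemma value_mul a b (r s t : R) : decided a -> decided b ->
  value a r -> value b s -> value (a * b) t -> t = (r + s)%R.
Proof.
  intros Da Db Ha Hb [Hl Hu]. apply Rle_antisym; apply Rnot_lt_le; intros H.
  - destruct (upper_above a r (r + (t - r - s) / 2)) as (u & U1 & U2); auto; [lra|].
    destruct (upper_above b s (s + (t - r - s) / 2)) as (v & V1 & V2); auto; [lra|].
    specialize (Hu _ (upper_mul _ _ _ _ U1 V1)). lra.
  - destruct (lower_below a r (r - (r + s - t) / 2)) as (u & U1 & U2); auto; [lra|].
    destruct (lower_below b s (s - (r + s - t) / 2)) as (v & V1 & V2); auto; [lra|].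
    specialize (Hl _ (lower_mul _ _ _ _ U1 V1)). lra.
Qed.

(** Otherwise a lower rational of [a] above [s + (j - i) / K] transfers to one of [b] above [s].
    This serves monotonicity, the supremum estimate and strict separation. *)
Lemma value_affine_le K i j a b (r s : R) : (0 < K)%nat -> decided a ->
  value a r -> value b s -> Q (a ^ K * g ^ i) (b ^ K * g ^ j) ->
  (INR K * r + INR i <= INR K * s + INR j)%R.
Proof.
  intros HK Da Ha [Hb _] H. apply Rnot_lt_le. intros L.
  assert (PK : (0 < INR K)%R) by now apply lt_0_INR.
  destruct (lower_below a r (s + (INR j - INR i) / INR K)) as (l & (N & m & k & HN & E & M) & Hl); auto.
  { apply Rmult_lt_reg_l with (INR K); auto.
    replace (INR K * (s + (INR j - INR i) / INR K))%R
      with (INR K * s + INR j - INR i)%R by (field; lra). lra. }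
  assert (PN : (0 < INR N)%R) by now apply lt_0_INR.
  assert (LB : lower b (l + (INR i - INR j) / INR K)).
  { exists (N * K)%nat, (K * m + N * i)%nat, (N * j + K * k)%nat.
    split; [now apply Nat.mul_pos_pos | split].
    - rewrite !plus_INR, !mult_INR.
      replace ((l + (INR i - INR j) / INR K) * (INR N * INR K))%R
        with (INR K * (l * INR N) + INR N * (INR i - INR j))%R by (field; lra).
      rewrite E. ring.
    - apply (lower_scale K) in M. apply (Q_pow _ _ N) in H. rewrite !scale_eq in H.
      rewrite !gpow_add.
      apply Q_trans with (a ^ (K * N) * g ^ (K * k) * g ^ (N * i)); auto using Q_refl.
      rewrite <- lg_mulA, (lg_mulC (g ^ (K * k))), lg_mulA, (Nat.mul_comm K N), lg_mulA.
      auto using Q_refl. }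
  specialize (Hb _ LB).
  replace ((INR i - INR j) / INR K)%R with (- ((INR j - INR i) / INR K))%R in Hb
    by (field; lra). lra.
Qed.

Lemma value_le a b (r s : R) : decided a -> value a r -> value b s -> Q a b -> (r <= s)%R.
Proof.
  intros Da Ha Hb H.
  pose proof (value_affine_le 1 0 0 a b r s) as K. simpl in K. rewrite !mul1r in K.
  specialize (K ltac:(lia) Da Ha Hb H). lra.
Qed.

(** If [u < t], take [2^j > 1 / (t - u)]; then [2^j t <= 2^j x_n + 1 <= 2^j u + 1] is absurd. *)
Lemma value_sup_le (a : nat -> G) (x : nat -> R) s (t u : R) : decided s -> value s t ->
  (forall n, value (a n) (x n)) -> (forall n, (x n <= u)%R) ->
  (forall j, exists n, Q (s ^ Nat.pow 2 j) (a n ^ Nat.pow 2 j * g)) -> (t <= u)%R.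
Proof.
  intros Ds Hs Ha Hu H. apply Rnot_lt_le. intros L.
  destruct (INR_unbounded (/ (t - u))) as [j Hj].
  destruct (H j) as [n Hn]. specialize (Hu n).
  assert (Hpow : (j < Nat.pow 2 j)%nat) by (apply Nat.pow_gt_lin_r; lia).
  pose proof (lt_INR _ _ Hpow) as HI. set (K := Nat.pow 2 j) in *.
  pose proof (value_affine_le K 0 1 s (a n) t (x n)) as B. simpl in B.
  rewrite !mul1r in B. specialize (B ltac:(lia) Ds Hs (Ha n) Hn).
  assert (C : (1 < INR K * (t - u))%R).
  { apply Rmult_lt_reg_r with (/ (t - u))%R; [apply Rinv_0_lt_compat; lra|].
    rewrite Rmult_assoc, Rinv_r; lra. }
  assert (D : (INR K * x n <= INR K * u)%R)
    by (apply Rmult_le_compat_l; auto using pos_INR).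
  lra.
Qed.

End Valuation.

(** * Points satisfying countably many relations *)

Inductive relation : Type :=
  | RMul (a b : G)
  | RSup (a : nat -> G) (s : G) (H : lg_is_sup G a s).

Definition holds (x : G -> R) (rho : relation) : Prop :=
  match rho with
  | RMul a b => x (a * b) = (x a + x b)%R
  | RSup a s _ => (forall n, (x (a n) <= x s)%R) /\
                  (forall u, (forall n, (x (a n) <= u)%R) -> (x s <= u)%R)
  end.

(** Countably many relations mention only countably many elements, which one generic sequence can
    decide. *)
Definition element (rho : relation) (n : nat) : G :=
  match rho, n with
  | RMul a _, 0%nat => a
  | RMul _ b, 1%nat => b
  | RMul a b, _ => a * b
  | RSup _ s _, 0%nat => s
  | RSup a _ _, S n => a n
  end.

(** [D] passes to smaller conditions, so it survives the extension that achieves [E]. *)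
Lemma dense_and g (D E : G -> Prop) :
  (forall p p', D p -> p' <= p -> D p') ->
  (forall p, cond p -> p <= g -> exists p', cond p' /\ p' <= p /\ D p') ->
  (forall p, cond p -> p <= g -> exists p', cond p' /\ p' <= p /\ E p') ->
  forall p, cond p -> p <= g -> exists p', cond p' /\ p' <= p /\ (D p' /\ E p').
Proof.
  intros HD H K p Hp Hg. destruct (H p Hp Hg) as (q & Hq & Lq & Dq).
  destruct (K q Hq) as (p' & Hp' & Lp' & Ep'); [eauto using lg_le_trans|].
  exists p'. eauto 6 using lg_le_trans.
Qed.

Definition forces_decided g c (N m k : nat) p : Prop :=
  ple p (g ^ m) (c ^ N * g ^ k) \/ ple p (c ^ N * g ^ k) (g ^ m).

Definition forces_bounded g c p : Prop :=
  exists n, ple p c (g ^ n) /\ ple p 1 (c * g ^ n).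

(** Products need no requirement of their own: [value_mul] yields additivity from decidedness. *)
Definition forces_sup g (rho : relation) j p : Prop :=
  match rho with
  | RMul _ _ => True
  | RSup a s _ => exists n, ple p (s ^ Nat.pow 2 j) (a n ^ Nat.pow 2 j * g)
  end.

Lemma forces_decided_dense g c N m k p : cond p ->
  exists p', cond p' /\ p' <= p /\ forces_decided g c N m k p'.
Proof.
  intros Hp. destruct (ple_total p (g ^ m) (c ^ N * g ^ k) Hp) as [H | (p' & H1 & H2 & H3)].
  - exists p. repeat split; try apply Hp; [apply lg_le_refl | now left].
  - exists p'. repeat split; try apply H1; auto. now right.
Qed.

Lemma forces_bounded_dense g c p : cond p -> p <= g ->
  exists p', cond p' /\ p' <= p /\ forces_bounded g c p'.
Proof.
  intros Hp Hg.
  assert (Hg1 : 1 <= g) by (apply lg_le_trans with p; [apply Hp | auto]).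
  destruct (ple_pow_bound p g c Hp Hg) as (p1 & n & Hp1 & L1 & H1).
  destruct (ple_pow_bound p1 g c^-1 Hp1) as (p2 & m & Hp2 & L2 & H2);
    [eauto using lg_le_trans|].
  exists p2. split; [auto | split; [eauto using lg_le_trans|]].
  exists (n + m)%nat. pose proof (proj1 Hp2) as P. rewrite gpow_add. split.
  - apply ple_trans with (g ^ n); [now apply ple_mono with p1|].
    apply ple_of_le. now apply le_mul_ge1_r, gpow_ge1.
  - apply (ple_cancel_l p2 c^-1); auto. rewrite mulKV, mul1r.
    apply ple_trans with (g ^ m); auto.
    apply ple_of_le. now apply le_mul_ge1_l, gpow_ge1.
Qed.

Lemma forces_sup_dense g rho j p : cond p -> p <= g ->
  exists p', cond p' /\ p' <= p /\ forces_sup g rho j p'.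
Proof.
  intros Hp Hg. destruct rho as [a b | a s H]; simpl.
  - exists p. auto using lg_le_refl.
  - destruct (ple_sup a s j p g H Hp Hg) as (p' & n & H1 & H2 & H3).
    exists p'. eauto.
Qed.

(** The first relation puts [a] and [b] among the decided elements; the sequence starts at [g],
    which forces [b g <= a]. *)
Lemma exists_point (rho : nat -> relation) a b :
  ~ a <= b -> rho O = RMul a b ->
  exists x : G -> R, (forall n, holds x (rho n)) /\ (x b < x a)%R.
Proof.
  intros Hab E0. set (g := lg_join (a * b^-1) 1).
  assert (Hg : cond g).
  { apply cond_pos_part. contradict Hab.
    apply (le_cancel_r b^-1). now rewrite mulVr. }
  assert (Hgab : ple g (b * g) a).
  { rewrite lg_mulC. apply (ple_cancel_r g b^-1); [apply Hg|].
    rewrite <- lg_mulA, mulVr, mul1r. apply ple_pos_part. }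
  (* The code [n] names element [e] of relation [i] and a fraction [N], [m], [k]; [N] doubles as the
     index [j] of [forces_sup]. *)
  set (D := fun n p =>
    let (n1, n2) := Cantor.of_nat n in
    let (i, e) := Cantor.of_nat n1 in
    let (N, n3) := Cantor.of_nat n2 in
    let (m, k) := Cantor.of_nat n3 in
    forces_decided g (element (rho i) e) N m k p /\
    (forces_bounded g (element (rho i) e) p /\ forces_sup g (rho i) N p)).
  destruct (generic_sequence g D Hg) as (P & P0 & Pcond & Pdec & PD).
  { intros n. unfold D. destruct (Cantor.of_nat n) as [n1 n2].
    destruct (Cantor.of_nat n1) as [i e], (Cantor.of_nat n2) as [N n3].
    destruct (Cantor.of_nat n3) as [m k]. apply dense_and.
    - intros p p' [H | H] Hp; [left | right]; now apply ple_mono with p.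
    - intros p Hp _. now apply forces_decided_dense.
    - apply dense_and.
      + intros p p' (l & H & K) Hp. exists l. split; now apply ple_mono with p.
      + intros p Hp Lp. now apply forces_bounded_dense.
      + intros p Hp Lp. now apply forces_sup_dense. }
  assert (Pmono : forall n m, P (m + n)%nat <= P n).
  { intros n m. induction m; simpl; eauto using lg_le_refl, lg_le_trans. }
  (* Stages decrease, so two inequalities in [Q] are always forced at a common stage. *)
  set (Q := fun c d => exists n, ple (P n) c d).
  assert (Q_le : forall c d, c <= d -> Q c d) by (intros; exists O; now apply ple_of_le).
  assert (Q_pair : forall c d c' d', Q c d -> Q c' d' ->
    exists n, ple (P n) c d /\ ple (P n) c' d').
  { intros c d c' d' [n H] [m K]. exists (n + m)%nat. split.
    - apply ple_mono with (P n); auto. rewrite Nat.add_comm. apply Pmono.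
    - apply ple_mono with (P m); auto. }
  assert (Q_trans : forall c d e, Q c d -> Q d e -> Q c e).
  { intros c d e H K. destruct (Q_pair _ _ _ _ H K) as (n & A & B).
    exists n. now apply ple_trans with d. }
  assert (Q_mul : forall c d c' d', Q c d -> Q c' d' -> Q (c * c') (d * d')).
  { intros c d c' d' H K. destruct (Q_pair _ _ _ _ H K) as (n & A & B).
    exists n. apply ple_mul; auto. apply Pcond. }
  assert (Q_nontrivial : ~ Q g 1).
  { intros [n H]. apply (not_ple_one (P n)); auto. apply ple_trans with g; auto.
    apply ple_of_le. rewrite <- P0. rewrite (plus_n_O n). apply Pmono. }
  assert (g_ge1 : 1 <= g) by apply Hg.
  assert (HD : forall i e N m k, exists n,
    forces_decided g (element (rho i) e) N m k (P n) /\
    (forces_bounded g (element (rho i) e) (P n) /\ forces_sup g (rho i) N (P n))).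
  { intros i e N m k.
    set (n := Cantor.to_nat (Cantor.to_nat (i, e), Cantor.to_nat (N, Cantor.to_nat (m, k)))).
    exists (S n). specialize (PD n). unfold D, n in PD.
    now rewrite !Cantor.cancel_of_to in PD. }
  assert (Hdecided : forall i e, decided g Q (element (rho i) e)).
  { intros i e N m k. destruct (HD i e N m k) as (n & [H | H] & _);
      [left | right]; now exists n. }
  assert (Hx : forall c, exists r : R, bounded g Q c -> value g Q c r).
  { intros c. destruct (classic (bounded g Q c)) as [H | H].
    - destruct (value_exists g Q g_ge1 Q_le Q_trans Q_mul Q_nontrivial c H) as [r Hr].
      now exists r.
    (* A default for unbounded elements, which no listed relation mentions. *)
    - exists 0%R. tauto. }
  apply functional_choice in Hx. destruct Hx as [x Hx].
  assert (Hvalue : forall i e, value g Q (element (rho i) e) (x (element (rho i) e))).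
  { intros i e. apply Hx. destruct (HD i e 0%nat 0%nat 0%nat) as (n & _ & (m & H & K) & _).
    exists m. split; now exists n. }
  exists x. split.
  - intros i. pose proof (Hdecided i) as Di. pose proof (Hvalue i) as Vi.
    destruct (rho i) as [c d | c s Hs] eqn:Ei; simpl.
    + apply (value_mul g Q Q_le Q_mul c d);
        [apply (Di 0%nat) | apply (Di 1%nat) | apply (Vi 0%nat) | apply (Vi 1%nat)
        | apply (Vi 2%nat)].
    + split.
      * intros n. apply (value_le g Q Q_le Q_trans Q_mul (c n) s);
          [apply (Di (S n)) | apply (Vi (S n)) | apply (Vi 0%nat)
          | apply Q_le, Hs].
      * intros u Hu.
        apply (value_sup_le g Q Q_le Q_trans Q_mul c (fun n => x (c n)) s); auto;
          [apply (Di 0%nat) | apply (Vi 0%nat) | intros n; apply (Vi (S n)) |].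
        intros j. destruct (HD i 0%nat j 0%nat 0%nat) as (n & _ & _ & H).
        rewrite Ei in H. destruct H as [l H]. exists l. now exists n.
  - pose proof (Hvalue O) as V. pose proof (Hdecided O) as D0. rewrite E0 in V, D0.
    (* The shifts [1] and [0] give [x b + 1 <= x a], from the inequality forced at stage [0]. *)
    pose proof (value_affine_le g Q Q_le Q_trans Q_mul 1 1 0 b a (x b) (x a)) as K.
    simpl in K. rewrite !mul1r in K.
    specialize (K ltac:(lia) (D0 1%nat) (V 1%nat) (V 0%nat)).
    rewrite <- P0 in Hgab at 1. specialize (K (ex_intro _ O Hgab)). lra.
Qed.

End LGroup.

(** * The sigma-ideal of negligible sets *)

Section Ideal.

Variable G : lgroup.

(** The sigma-ideal generated by the failure sets of single relations. *)
Definition negligible (A : (G -> R) -> Prop) : Prop :=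
  exists rho : nat -> relation G,
    forall x, (forall n, holds G x (rho n)) -> ~ A x.

(** The witnessing lists are merged into one along the Cantor pairing. *)
Lemma negligible_union (A : nat -> (G -> R) -> Prop) (B : (G -> R) -> Prop) :
  (forall n, negligible (A n)) -> (forall x, B x -> exists n, A n x) -> negligible B.
Proof.
  intros HA HB. apply functional_choice in HA. destruct HA as [rho Hrho].
  exists (fun n => let (i, j) := Cantor.of_nat n in rho i j).
  intros x Hx Bx. destruct (HB x Bx) as [i Ai]. apply (Hrho i x); auto.
  intros j. specialize (Hx (Cantor.to_nat (i, j))).
  now rewrite Cantor.cancel_of_to in Hx.
Qed.

Lemma negligible_not_holds (rho : relation G) : negligible (fun x => ~ holds G x rho).
Proof. exists (fun _ => rho). intros x Hx H. exact (H (Hx O)). Qed.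

Lemma negligible_subset (A B : (G -> R) -> Prop) :
  negligible A -> (forall x, B x -> A x) -> negligible B.
Proof.
  intros HA HB. apply (negligible_union (fun _ => A)); auto.
  intros x H. exists O. auto.
Qed.

(** Presents a binary join as a countable supremum, so that [RSup] covers it. *)
Definition pair_seq (a b : G) (n : nat) : G :=
  match n with O => a | _ => b end.

Lemma join_is_sup (a b : G) : lg_is_sup G (pair_seq a b) (lg_join a b).
Proof.
  split.
  - intros [|n]; [apply lg_join_ubl | apply lg_join_ubr].
  - intros u Hu. apply lg_join_least; [apply (Hu 0%nat) | apply (Hu 1%nat)].
Qed.

Lemma holds_join (x : G -> R) (a b : G) :
  holds G x (RSup G _ _ (join_is_sup a b)) -> x (lg_join a b) = Rmax (x a) (x b).
Proof.
  intros [H1 H2]. apply Rle_antisym.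
  - apply H2. intros [|n]; simpl; [apply Rmax_l | apply Rmax_r].
  - apply Rmax_lub; [apply (H1 0%nat) | apply (H1 1%nat)].
Qed.

End Ideal.

(** * The embedding by evaluation *)

Theorem mainTheorem10 (G : lgroup) (HG : dedekind_sigma_complete G) :
  exists (X : Type) (I : (X -> Prop) -> Prop) (phi : G -> X -> R),
    sigma_ideal X I /\ is_lmorphism G I phi /\ q_injective G I phi /\
    sigma_continuous G I phi.
Proof.
  pose proof (sigma_complete_archimedean G HG) as arch.
  exists (G -> R), (negligible G), (fun a x => x a).
  split; [|split; [|split]].
  - split; [|split].
    + exists (fun _ => RMul G (lg_one G) (lg_one G)). tauto.
    + intros A B HAB HA. now apply negligible_subset with A.
    + intros A HA. now apply negligible_union with A.
  - split; [|split]; intros a b.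
    + apply (negligible_not_holds G (RMul G a b)).
    + apply negligible_subset with (1 := negligible_not_holds G (RSup G _ _ (join_is_sup G a b))).
      intros x H K. now apply H, holds_join.
    (* Meet times join is [a b]; subtracting the maximum, which is the value of the join, leaves the
       minimum. *)
    + exists (fun n => match n with
        | 0%nat => RMul G a b
        | 1%nat => RMul G (lg_meet a b) (lg_join a b)
        | _ => RSup G _ _ (join_is_sup G a b) end).
      intros x Hx. specialize (Hx 0%nat) as E. specialize (Hx 1%nat) as F.
      specialize (Hx 2%nat) as J. apply holds_join in J. simpl in E, F.
      rewrite meet_mul_join in F by auto. intros K. apply K.
      unfold Rmin, Rmax in *. destruct (Rle_dec (x a) (x b)); lra.
  - intros a b [rho H].
    assert (K : forall c d, ~ lg_le c d -> (c = a /\ d = b) \/ (c = b /\ d = a) -> False).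
    { intros c d Hcd Hor.
      (* [RMul c d] is prepended as [exists_point] demands. The resulting point separates [a] and
         [b] although it satisfies all of [rho]. *)
      destruct (exists_point G arch (fun n => match n with O => RMul G c d | S n => rho n end)
        c d Hcd eq_refl) as (x & Hx & Hlt).
      apply (H x); [intros n; apply (Hx (S n))|].
      destruct Hor as [[-> ->] | [-> ->]]; lra. }
    apply lg_le_anti; apply NNPP; intros Hn; eapply K; eauto.
  - intros a s Hs. split.
    + intros n. apply negligible_subset with (1 := negligible_not_holds G (RSup G a s Hs)).
      intros x H [K _]. specialize (K n). lra.
    (* Where the relation for [s] holds, [u x < x s] gives [u x < x (a n)] for some [n], so
       countably many negligible sets cover the failure set. *)
    + intros u Hu. apply (negligible_union G (fun n => match n with
        | O => fun x => ~ holds G x (RSup G a s Hs)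
        | S n => fun x => u x < x (a n) end)).
      * intros [|n]; [apply negligible_not_holds | apply Hu].
      * intros x Hx. apply NNPP. intros Hno.
        assert (K : holds G x (RSup G a s Hs))
          by (apply NNPP; intros K; apply Hno; now exists O).
        apply (Rlt_not_le _ _ Hx). apply K. intros n. apply Rnot_lt_le. intros L.
        apply Hno. now exists (S n).
Qed.
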